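(* If $\mathcal P$ is an infinite hereditary graph class, then $\widehat{\mathcal P}$ contains either $[0]$ or $[1]$ (or both).
   Context: All graphs are finite and simple (with at least one vertex). $\mathcal U$ is the set of all unlabelled graphs (isomorphism classes of graphs), and $|G|$ is the number of vertices of $G$. A graph class is a subset of $\mathcal U$; it is hereditary if every induced subgraph of a graph in the class is also in the class. For graphs $F,G$, $t(F,G)$ is the probability that a uniformly random map $V(F)\to V(G)$ is a graph homomorphism. The space $\overline{\mathcal U}$: embed $\mathcal U$ in $[0,1]^{\mathcal U}\times[0,1]$ by $G\mapsto((t(F,G))_{F\in\mathcal U},1/|G|)$ and let $\overline{\mathcal U}$ be the closure of the image; it is a compact metrizable space in which $\mathcal U$ is a countable, discrete, dense, open subset. The elements of $\widehat{\mathcal U}:=\overline{\mathcal U}\setminus\mathcal U$ are called graph limits. For each fixed $F$, $t(F,\cdot)$ extends by continuity to $\overline{\mathcal U}$, and a graph limit $\Gamma$ is determined by the numbers $t(F,\Gamma)$. For $\mathcal P\subseteq\mathcal U$, $\overline{\mathcal P}$ is its closure in $\overline{\mathcal U}$ and $\widehat{\mathcal P}:=\overline{\mathcal P}\cap\widehat{\mathcal U}$, the set of graph limits of sequences of graphs in $\mathcal P$. $[0]$ and $[1]$ denote the graph limits represented by the constant graphons $0$ and $1$, respectively: $t(F,[1])=1$ for every graph $F$, while $t(F,[0])=0$ for every $F$ with at least one edge and $t(F,[0])=1$ for every $F$ without edges. *)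

(* Defs.v *)
From HB Require Import structures.
From mathcomp Require Import all_boot all_order all_algebra.
From mathcomp Require Import generic_quotient.
From mathcomp Require Import all_classical all_reals all_analysis.
Import Order.TTheory GRing.Theory Num.Theory.
Import numFieldNormedType.Exports.

Set Implicit Arguments.
Unset Strict Implicit.
Unset Printing Implicit Defensive.

Local Open Scope classical_set_scope.
Local Open Scope ring_scope.

(* Up to isomorphism every finite graph with at least one vertex has vertex
   set {0, ..., n} for some n : nat; taking this as the representation keeps
   the labelled graphs in a small type. *)
Record sgraph : Type := SGraph {
  order_pred : nat;
  edge : rel 'I_order_pred.+1;
  edge_sym : symmetric edge;
  edge_irr : irreflexive edge
}.

HB.instance Definition _ := gen_eqMixin sgraph.
HB.instance Definition _ := gen_choiceMixin sgraph.

Definition vertex (G : sgraph) : finType := 'I_(order_pred G).+1.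
Definition adj (G : sgraph) : rel (vertex G) := @edge G.

Definition isomorphic (V W : Type) (e : rel V) (e' : rel W) : Prop :=
  exists f : V -> W, bijective f /\ forall x y, e' (f x) (f y) = e x y.

Lemma isomorphic_refl (V : Type) (e : rel V) : isomorphic e e.
Proof. by exists id; split=> //; exists id. Qed.

Lemma isomorphic_sym (V W : Type) (e : rel V) (e' : rel W) :
  isomorphic e e' -> isomorphic e' e.
Proof.
move=> [f [[g fK gK] fe]]; exists g; split; first by exists f.
by move=> x y; rewrite -fe !gK.
Qed.

Lemma isomorphic_trans (U V W : Type) (e : rel U) (e' : rel V) (e'' : rel W) :
  isomorphic e e' -> isomorphic e' e'' -> isomorphic e e''.
Proof.
move=> [f [fb fe]] [g [gb ge]]; exists (g \o f); split; first exact: bij_comp.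
by move=> x y; rewrite /= ge fe.
Qed.

Definition iso_rel : rel sgraph :=
  fun G H => `[< isomorphic (@adj G) (@adj H) >].

Lemma iso_rel_refl : reflexive iso_rel.
Proof. by move=> G; apply/asboolP/isomorphic_refl. Qed.

Lemma iso_rel_sym : symmetric iso_rel.
Proof.
by move=> G H; apply/asboolP/asboolP; apply: isomorphic_sym.
Qed.

Lemma iso_rel_trans : transitive iso_rel.
Proof.
move=> H G K /asboolP GH /asboolP HK.
exact/asboolP/(isomorphic_trans GH HK).
Qed.

Canonical iso_equiv := EquivRel iso_rel iso_rel_refl iso_rel_sym iso_rel_trans.

(* The set of unlabelled graphs.  Isomorphism invariants are evaluated below on
   the representative [repr G] of the isomorphism class [G]. *)
Definition ugraph : Type := {eq_quot iso_rel}%qT.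
HB.instance Definition _ := EqQuotient.on ugraph.
HB.instance Definition _ := Choice.on ugraph.

Definition induced (G : sgraph) (S : {set vertex G}) : rel {x | x \in S} :=
  fun x y => adj (val x) (val y).

(* [S] is automatically nonempty here, since [H] has at least one vertex. *)
Definition hereditary (P : set ugraph) : Prop :=
  forall (G H : ugraph) (S : {set vertex (repr G)}),
    P G -> isomorphic (@adj (repr H)) (@induced (repr G) S) -> P H.

Definition is_hom (F G : sgraph) (f : {ffun vertex F -> vertex G}) : bool :=
  [forall x, forall y, adj x y ==> adj (f x) (f y)].

Section GraphLimits.
Variable R : realType.

Definition hom_density (F G : sgraph) : R :=
  #|[set f : {ffun vertex F -> vertex G} | is_hom f]|%:R
  / #|{ffun vertex F -> vertex G}|%:R.

Definition t (F G : ugraph) : R := hom_density (repr F) (repr G).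

(* R^U x R with the product topology.  As [0,1]^U x [0,1] is a closed subspace
   of it, closures of sets of graphs are the same in both. *)
Definition ambient : topologicalType := ({ptws ugraph -> R} * R)%type.

Definition embed (G : ugraph) : ambient :=
  (fun F => t F G, #|vertex (repr G)|%:R^-1).

(* Graphs are identified with their images under [embed]. *)
Definition Ubar : set ambient := closure (range embed).

Definition graph_limits : set ambient := Ubar `\` range embed.

Definition limits_of (P : set ugraph) : set ambient :=
  closure (embed @` P) `&` graph_limits.

Definition has_edge (F : sgraph) : bool := [exists x : vertex F, exists y, adj x y].

(* The limits represented by the constant graphons 0 and 1.  The value of
   t(F, .) at a point of [Ubar] is its coordinate at [F]; the last coordinate,
   which extends 1/|G|, vanishes at every graph limit. *)
Definition limit0 : ambient :=
  (fun F => if has_edge (repr F) then 0 else 1, 0).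

Definition limit1 : ambient := (fun=> 1, 0).

End GraphLimits.

(* Main.v *)
Require Import Defs.
From mathcomp Require Import all_boot all_order all_algebra.
From mathcomp Require Import generic_quotient zify.
From mathcomp Require Import all_classical all_reals all_analysis.
Import Order.TTheory GRing.Theory Num.Theory.
Import numFieldNormedType.Exports.

Set Implicit Arguments.
Unset Strict Implicit.
Unset Printing Implicit Defensive.

Local Open Scope classical_set_scope.

(** Only finitely many unlabelled graphs have a given order, so an infinite
    class [P] contains graphs of arbitrarily large order.  By Ramsey's theorem
    these contain large cliques or large independent sets, and heredity puts
    the corresponding complete or empty graphs in [P].  If some complete graph
    [K_m] is missing from [P], Ramsey's theorem with the clique size fixed at
    [m] puts every empty graph in [P]; hence [P] contains all complete graphs
    or all empty graphs ([complete_or_empty]).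

    It remains to see that these two sequences have the expected limits.  For
    empty graphs the densities t(F, .) do not depend on the order at all
    ([t_empty]).  For complete graphs every injective map is a homomorphism,
    and a map from a k-set to an n-set is injective with probability at least
    1 - k^2 / n ([ffact_ge], [t_complete_ge]).  Convergence of every density,
    together with 1/|G| -> 0, is convergence in the ambient product space, and
    a point whose last coordinate is 0 is not the image of a graph
    ([limits_of_cvg]). *)

(** * Ramsey's theorem *)

Definition homogeneous (V : finType) (e : rel V) (b : bool) (S : {set V}) :=
  forall x y, x \in S -> y \in S -> x != y -> e x y = b.

Lemma homogeneous0 (V : finType) (e : rel V) (b : bool) :
  homogeneous e b finset.set0.
Proof. by move=> x y; rewrite inE. Qed.

Lemma homogeneousU1 (V : finType) (e : rel V) (b : bool) (x : V)
    (A : {set V}) :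
  symmetric e -> homogeneous e b A -> {in A, forall y, e x y = b} ->
  homogeneous e b (x |: A).
Proof.
move=> esym Ah Ax y z; rewrite !inE.
move=> /orP[/eqP->|yA] /orP[/eqP->|zA]; rewrite ?eqxx// => yz.
- exact: Ax.
- by rewrite esym; exact: Ax.
- exact: Ah.
Qed.

(** The Erdos-Szekeres induction: among the other vertices of [S], the
    neighbours or the non-neighbours of a vertex [x] number at least half of
    the bound, and [x] can be added to any homogeneous set of the matching kind
    found among them.  The two target sizes are kept independent
    because [complete_or_empty] fixes one and lets the other grow. *)
Lemma ramsey (V : finType) (e : rel V) (m n : nat) (S : {set V}) :
  symmetric e -> 2 ^ (m + n) <= #|S| ->
  (exists A : {set V}, [/\ A \subset S, #|A| = m & homogeneous e true A]) \/
  (exists A : {set V}, [/\ A \subset S, #|A| = n & homogeneous e false A]).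
Proof.
move=> esym; elim: m n S => [n S _|m IHm].
  left; exists finset.set0.
  by rewrite finset.sub0set cards0; split=> //; exact: homogeneous0.
elim=> [S _|n IHn S leS].
  right; exists finset.set0.
  by rewrite finset.sub0set cards0; split=> //; exact: homogeneous0.
have /card_gt0P[x xS] : 0 < #|S| by apply: leq_trans leS; rewrite expn_gt0.
pose N b := [set y in S :\ x | e x y == b].
have cardN : #|S| = (#|N true| + #|N false|).+1.
  rewrite (cardsD1 x) xS add1n; congr _.+1.
  rewrite -(cardsID (N true) (S :\ x)).
  by congr (_ + _); apply: eq_card => y; rewrite !inE;
    case: (y \in S); case: (y == x); case: (e x y).
have NS b : N b \subset S.
  by apply/fintype.subsetP => y; rewrite !inE => /andP[/andP[]].
have extend b (A : {set V}) : A \subset N b -> homogeneous e b A ->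
    [/\ x |: A \subset S, #|x |: A| = #|A|.+1 & homogeneous e b (x |: A)].
  move=> AN Ah; split.
  - by rewrite finset.subUset finset.sub1set xS (fintype.subset_trans AN).
  - rewrite cardsU1; suff -> : x \notin A by [].
    by apply/negP => /(fintype.subsetP AN); rewrite !inE eqxx.
  - apply: homogeneousU1 => // y /(fintype.subsetP AN).
    by rewrite !inE => /andP[_ /eqP].
have [leT|leF] : 2 ^ (m + n.+1) <= #|N true| \/ 2 ^ (m.+1 + n) <= #|N false|.
  by move: leS; rewrite cardN !addSn !addnS expnS; lia.
- have [[A [AN <- Ah]]|[A [AN Ac Ah]]] := IHm _ _ leT.
    by left; exists (x |: A); exact: extend.
  by right; exists A; split=> //; exact: fintype.subset_trans AN (NS _).
- have [[A [AN Ac Ah]]|[A [AN <- Ah]]] := IHn _ leF.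
    by left; exists A; split=> //; exact: fintype.subset_trans AN (NS _).
  by right; exists (x |: A); exact: extend.
Qed.

(** * Complete and empty graphs *)

Definition const_rel (V : eqType) (b : bool) : rel V :=
  fun x y => b && (x != y).

Lemma const_rel_sym (V : eqType) b : symmetric (@const_rel V b).
Proof. by move=> x y; rewrite /const_rel eq_sym. Qed.

Lemma const_rel_irr (V : eqType) b : irreflexive (@const_rel V b).
Proof. by move=> x; rewrite /const_rel eqxx andbF. Qed.

(** The complete graph ([b = true]) or the empty graph ([b = false]) on [n.+1]
    vertices. *)
Definition const_graph (b : bool) (n : nat) : ugraph :=
  \pi_ugraph%qT
    (SGraph (@const_rel_sym 'I_n.+1 b) (@const_rel_irr 'I_n.+1 b)).

(** [repr] need not give back the labelled graph that was projected, so what is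
    known of an unlabelled graph has to pass through an isomorphism. *)
Lemma repr_ugraphP (G : sgraph) :
  isomorphic (@adj (repr (\pi_ugraph%qT G))) (@adj G).
Proof.
by apply/asboolP; have /eqmodP := reprK (\pi_ugraph%qT G).
Qed.

Lemma const_graph_isoP b n :
  isomorphic (@adj (repr (const_graph b n))) (@const_rel 'I_n.+1 b).
Proof. exact: repr_ugraphP. Qed.

Lemma card_const_graph b n : #|vertex (repr (const_graph b n))| = n.+1.
Proof.
have [f [f_bij _]] := const_graph_isoP b n.
by rewrite (bij_eq_card f_bij) card_ord.
Qed.

Lemma const_graph_adj b n : @adj (repr (const_graph b n)) =2 const_rel b.
Proof.
have [f [f_bij fE]] := const_graph_isoP b n.
by move=> x y; rewrite -fE /const_rel (bij_eq f_bij).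
Qed.

(** * Hereditary classes contain all complete or all empty graphs *)

Lemma hereditary_homogeneous {P : set ugraph} {G : ugraph} {b n}
    {S : {set vertex (repr G)}} :
  hereditary P -> P G -> #|S| = n.+1 -> homogeneous (@adj (repr G)) b S ->
  P (const_graph b n).
Proof.
move=> hP PG Sn Sh; apply: (hP G _ S PG).
apply: isomorphic_trans (const_graph_isoP b n) _.
exists (fun i => exist (fun x => x \in S) (enum_val (cast_ord (esym Sn) i))
              (enum_valP _)).
have cardS : #|{: {x | x \in S}}| = n.+1.
  by rewrite card_sig -Sn; apply: eq_card.
split.
  apply: inj_card_bij; last by rewrite cardS card_ord.
  by move=> i j [] /enum_val_inj/cast_ord_inj.
move=> i j; rewrite /induced /const_rel /=.
have [->|ij] := eqVneq i j; first by rewrite andbF; exact: edge_irr.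
rewrite andbT; apply: Sh; rewrite ?enum_valP//.
by apply: contra_neq ij => /enum_val_inj/cast_ord_inj.
Qed.

(** A graph with at most [n.+1] vertices is determined up to isomorphism by its
    order and by its adjacency matrix padded to a fixed size, and there are
    finitely many such pairs. *)
Lemma finite_order_le (n : nat) :
  finite_set [set G : ugraph | order_pred (repr G) <= n].
Proof.
(* Out of range, [inord] falls back on vertex 0: the padding is junk, but it is
   never consulted once the orders are known to agree. *)
pose code (G : ugraph) : 'I_n.+1 * {ffun 'I_n.+1 * 'I_n.+1 -> bool} :=
  (inord (order_pred (repr G)),
   [ffun p => @edge (repr G) (inord (val p.1)) (inord (val p.2))]).
suff codeI : {in [set G : ugraph | order_pred (repr G) <= n] &, injective code}.
  by rewrite -(eq_finite_set (inj_card_eq codeI)); exact: finite_finset.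
move=> G H; rewrite !inE /= => Gn Hn [].
move=> /(congr1 val); rewrite /= !inordK ?ltnS// => GH /ffunP edgeE.
rewrite -[G]reprK -[H]reprK; apply/eqmodP/asboolP.
move: Gn Hn GH edgeE; rewrite /adj.
case: (repr G) => g e es ei; case: (repr H) => h e' es' ei' /= gn _ gh.
move: e' es' ei'; rewrite -{h}gh => e' _ _ edgeE.
exists id; split; first by exists id.
move=> x y; pose w := @widen_ord g.+1 n.+1 gn; have := edgeE (w x, w y).
by rewrite !ffunE /= !inord_val => ->.
Qed.

Lemma infinite_order_gt (P : set ugraph) (n : nat) :
  infinite_set P -> exists2 G, P G & n <= order_pred (repr G).
Proof.
move=> Pinf; apply: contrapT => small; apply: Pinf.
apply: sub_finite_set (finite_order_le n) => G PG /=.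
by rewrite leqNgt; apply/negP => /ltnW nG; apply: small; exists G.
Qed.

(** A Ramsey dichotomy at each pair of sizes does not by itself decide between
    the two families; the size of a missing complete graph does. *)
Lemma complete_or_empty (P : set ugraph) :
  infinite_set P -> hereditary P ->
  exists b, forall n, P (const_graph b n).
Proof.
move=> Pinf hP.
have dich m n : P (const_graph true m) \/ P (const_graph false n).
  have [G PG leG] := infinite_order_gt (2 ^ (m.+1 + n.+1)) Pinf.
  have := @ramsey _ (@adj (repr G)) m.+1 n.+1 [set: vertex (repr G)]%SET
    (@edge_sym (repr G)).
  rewrite cardsT card_ord => /(_ (leqW leG)) [] [A [_ Ac Ah]]; [left|right];
    exact: hereditary_homogeneous hP PG Ac Ah.
have [allT|/existsNP[m nPm]] := pselect (forall n, P (const_graph true n)).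
  by exists true.
by exists false => n; have [] := dich m n.
Qed.

(** * Homomorphism densities of complete and empty graphs *)

(** Division by [n ^ k.+1] turns this into the birthday bound: a map from a
    k-set to an n-set is injective with probability at least 1 - k^2 / n. *)
Lemma ffact_ge (n k : nat) : n * n ^ k <= n * n ^_ k + k ^ 2 * n ^ k.
Proof.
elim: k => [|k IHk]; first by rewrite ffactn0 expn0 leq_addr.
have ffact_le : n ^_ k <= n ^ k.
  by elim: k {IHk} => // k IHk; rewrite ffactnSr expnSr leq_mul ?leq_subr.
rewrite ffactnSr expnSr.
move: (n ^_ k) (n ^ k) IHk ffact_le => a p IHk ap.
have split_a : a * n <= a * (n - k) + p * k by nia.
by have := leq_mul (leqnn n) IHk; have := leq_mul (leqnn n) split_a; nia.
Qed.

Section Densities.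
Variable R : realType.
Local Open Scope ring_scope.

(** The set of homomorphisms in [hom_density] is a classical set; a boolean
    predicate gives access to the counting lemmas for finite types. *)
Lemma hom_densityE (F G : sgraph) :
  hom_density R F G =
  #|[pred f : {ffun vertex F -> vertex G} | is_hom f]|%:R
  / #|{ffun vertex F -> vertex G}|%:R.
Proof.
congr (_%:R / _); apply: eq_card => f.
by rewrite inE; apply/idP/idP; rewrite in_setE.
Qed.

Lemma hom_density_le1 (F G : sgraph) : hom_density R F G <= 1.
Proof.
rewrite hom_densityE ler_pdivrMr; last first.
  by rewrite ltr0n card_ffun expn_gt0 card_ord.
by rewrite mul1r ler_nat max_card.
Qed.

Lemma t_empty (F : ugraph) (n : nat) :
  t R F (const_graph false n) = if has_edge (repr F) then 0 else 1.
Proof.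
rewrite /t hom_densityE; case: ifPn => [/existsP[x /existsP[y xy]]|noedge].
  rewrite eq_card0 ?mul0r// => f; rewrite inE; apply/negbTE/forallPn; exists x.
  by apply/forallPn; exists y; rewrite xy const_graph_adj.
rewrite (@eq_card _ _ predT) ?divff//.
  by rewrite pnatr_eq0 -lt0n card_ffun expn_gt0 card_ord.
move=> f; rewrite !inE; apply/forallP => x; apply/forallP => y.
apply/implyP => xy; case/negP: noedge; apply/existsP; exists x.
by apply/existsP; exists y.
Qed.

Lemma t_complete_ge (F : ugraph) (n : nat) :
  1 - (#|vertex (repr F)| ^ 2)%:R * harmonic n <= t R F (const_graph true n).
Proof.
rewrite /t hom_densityE /= card_ffun card_const_graph.
set k := #|vertex (repr F)|; set h := #|_|.
have hk : (n.+1 ^_ k <= h)%N.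
  rewrite -(card_const_graph true n) -card_inj_ffuns; apply: subset_leq_card.
  apply/fintype.subsetP => f; rewrite !inE => /injectiveP f_inj.
  apply/forallP => x; apply/forallP => y; apply/implyP => xy.
  rewrite const_graph_adj /const_rel (inj_eq f_inj) /=.
  by apply: contraTneq xy => ->; rewrite /adj edge_irr.
have := leq_trans (ffact_ge n.+1 k) (leq_add (leq_mul (leqnn _) hk) (leqnn _)).
rewrite ler_pdivlMr ?ltr0n ?expn_gt0// -(ler_nat R) natrD !natrM => le.
rewrite -(ler_pM2l (ltr0Sn R n)) mulrBl mul1r mulrBr lerBlDr.
rewrite (le_trans le)// lerD2l.
by rewrite -[X in _ <= n.+1%:R * X]mulrA [X in _ <= X]mulrCA mulVKf ?pnatr_eq0.
Qed.

Lemma cvg_t_complete (F : ugraph) :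
  t R F (const_graph true n) @[n --> \oo] --> (1 : R).
Proof.
apply: (@squeeze_cvgr _ _ _ _
  (fun n => 1 - (#|vertex (repr F)| ^ 2)%:R * harmonic n) (fun=> 1)).
- by apply: nearW => n; rewrite t_complete_ge hom_density_le1.
- rewrite -[X in _ --> X]subr0.
  rewrite -[X in _ --> _ - X](mulr0 (#|vertex (repr F)| ^ 2)%:R).
  by apply: cvgB; [exact: cvg_cst|apply: cvgMr; exact: cvg_harmonic].
- exact: cvg_cst.
Qed.

(** * Graph limits of sequences *)

Lemma limits_of_cvg (P : set ugraph) (u : nat -> ugraph) (f : ugraph -> R) :
  (forall n, P (u n)) ->
  (forall F, t R F (u n) @[n --> \oo] --> f F) ->
  (#|vertex (repr (u n))|%:R^-1 : R) @[n --> \oo] --> (0 : R) ->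
  limits_of P ((f, 0) : ambient R).
Proof.
move=> Pu tu u0.
have eu : embed R (u n) @[n --> \oo] --> ((f, 0) : ambient R).
  apply: (@cvg_pair _ _ _ \oo (nbhs (f : {ptws ugraph -> R})) (nbhs (0 : R))
    _ _ _ (fun n F => t R F (u n)) _ _ u0).
  (* The pointwise topology does not see the topology of the index type; the
     discrete one only makes the pointwise criterion applicable. *)
  by apply/(@pointwise_cvgP (discrete_topology ugraph) R) => F; exact: tu.
have clP : closure (embed R @` P) (f, 0).
  apply: (@closed_cvg _ _ \oo _ (embed R \o u) _
    (@closed_closure _ (embed R @` P)) _ _ eu).
  by apply: nearW => n; apply: subset_closure; exists (u n).
split=> //; split; first by apply: closureS clP => _ [G _ <-]; exists G.
(* The last coordinate of the image of a graph is the inverse of its order. *)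
move=> [G _ [_ /eqP]]; apply/negP.
by rewrite invr_eq0 pnatr_eq0 card_ord.
Qed.

End Densities.

Theorem theorem9p4 (R : realType) (P : set ugraph) :
  infinite_set P -> hereditary P ->
  limits_of P (limit0 R) \/ limits_of P (limit1 R).
Proof.
move=> Pinf hP; have [b Pb] := complete_or_empty Pinf hP.
have card0 : (#|vertex (repr (const_graph b n))|%:R^-1 : R)%R
    @[n --> \oo] --> (0 : R)%R.
  by under eq_fun do rewrite card_const_graph; exact: cvg_harmonic.
case: b Pb card0 => Pb card0; [right|left]; apply: limits_of_cvg Pb _ card0.
  exact: cvg_t_complete.
by move=> F; under eq_fun do rewrite t_empty; exact: cvg_cst.
Qed.
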